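(* Let $\mathcal{K}_0\subseteq\mathbb{R}^{n_1}$ and $\mathcal{K}_i\subseteq\mathbb{R}^{n_2}$, $i\in[1:S]$, be closed convex cones and $\bar{\mathcal{K}}:=(\mathcal{K}_0,\dots,\mathcal{K}_S)$. Then $\mathcal{CPI}(\bar{\mathcal{K}})\supseteq\mathcal{CMP}(\bar{\mathcal{K}})$.
   Context: Notation: $[1:S]=\{1,\dots,S\}$. For a closed convex cone $\mathcal{K}\subseteq\mathbb{R}^m$ the set-completely positive cone is $\mathcal{CPP}(\mathcal{K}):=\{\sum_{l=1}^{p}x_lx_l^{\mathsf T} : x_l\in\mathcal{K},\ p\in\mathbb{N}\}$. $[M_i]_{i\in[1:S]}$ denotes an $S$-tuple of symmetric $(n_1+n_2)\times(n_1+n_2)$ matrices $M_i=\begin{pmatrix}X&Z_i^{\mathsf T}\\ Z_i&Y_i\end{pmatrix}$ sharing the same upper-left $n_1\times n_1$ block $X$; such tuples form a vector space $\mathcal{S}^{S,n_1}_{n_1+n_2}$ with componentwise operations. In this space, $$\mathcal{CMP}(\bar{\mathcal{K}}):=\operatorname{conv}\left\{\left[\begin{pmatrix}x\\ y_i\end{pmatrix}\begin{pmatrix}x\\ y_i\end{pmatrix}^{\mathsf T}\right]_{i\in[1:S]} : x\in\mathcal{K}_0,\ y_i\in\mathcal{K}_i,\ i\in[1:S]\right\},$$ $$\mathcal{CPI}(\bar{\mathcal{K}}):=\left\{\left[\begin{pmatrix}X&Z_i^{\mathsf T}\\ Z_i&Y_i\end{pmatrix}\right]_{i\in[1:S]}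 : \begin{pmatrix}X&Z_i^{\mathsf T}\\ Z_i&Y_i\end{pmatrix}\in\mathcal{CPP}(\mathcal{K}_0\times\mathcal{K}_i),\ i\in[1:S]\right\}.$$ *)

(* Defs.v *)
From HB Require Import structures.
From mathcomp Require Import all_boot all_order all_algebra.
From mathcomp Require Import boolp classical_sets reals topology normedtype convex.

Set Implicit Arguments.
Unset Strict Implicit.
Unset Printing Implicit Defensive.

Import Order.TTheory GRing.Theory Num.Theory numFieldNormedType.Exports.
Local Open Scope classical_set_scope.
Local Open Scope ring_scope.

Section Space.
Variables (R : realType) (S n1 n2 : nat).

Definition shared_sym : {pred {ffun 'I_S -> 'M[R]_(n1 + n2)}} :=
  fun M => [forall i, (M i)^T == M i] &&
           [forall i, forall j, ulsubmx (M i) == ulsubmx (M j)].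

Lemma shared_symP (M : {ffun 'I_S -> 'M[R]_(n1 + n2)}) :
  reflect ((forall i, (M i)^T = M i) /\
           (forall i j, ulsubmx (M i) = ulsubmx (M j)))
          (M \in shared_sym).
Proof.
apply: (iffP andP) => [[/forallP h1 /forallP h2]|[h1 h2]]; split.
- by move=> i; apply/eqP.
- by move=> i j; apply/eqP; have /forallP := h2 i.
- by apply/forallP => i; apply/eqP.
- by apply/forallP => i; apply/forallP => j; apply/eqP.
Qed.

Lemma shared_sym_submod_closed : submod_closed shared_sym.
Proof.
split=> [|a u v /shared_symP[us ub] /shared_symP[vs vb]]; apply/shared_symP.
  by split=> [i|i j]; rewrite !ffunE ?trmx0.
have trP (A B : 'M[R]_(n1 + n2)) : (a *: A + B)^T = a *: A^T + B^T.
  by apply/matrixP => i j; rewrite !mxE.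
have ulP (A B : 'M[R]_(n1 + n2)) :
    ulsubmx (a *: A + B) = a *: ulsubmx A + ulsubmx B.
  by apply/matrixP => i j; rewrite !mxE.
split=> [i|i j]; rewrite !ffunE; first by rewrite [LHS]trP us vs.
by rewrite [LHS]ulP [RHS]ulP (ub i j) (vb i j).
Qed.

HB.instance Definition _ :=
  GRing.isSubmodClosed.Build R _ shared_sym shared_sym_submod_closed.

(* The vector space of S-tuples of symmetric matrices of order n1 + n2 sharing
   their upper-left n1 x n1 block; [M i] is the i-th matrix of [M]. *)
Record sym_tuple := SymTuple {
  sym_tuple_val :> {ffun 'I_S -> 'M[R]_(n1 + n2)};
  _ : sym_tuple_val \in shared_sym }.

HB.instance Definition _ := [isSub for sym_tuple_val].
HB.instance Definition _ := [Choice of sym_tuple by <:].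
HB.instance Definition _ := [SubChoice_isSubLmodule of sym_tuple by <:].

End Space.

(* Neither nonemptiness nor [K 0] is required: a nonempty [K] contains 0
   (take t = 0), so only the empty set is additionally admitted. *)
Definition closed_convex_cone (R : realType) (m : nat) (K : set 'cV[R]_m) :=
  [/\ closed K, convex_set K &
      forall (t : R) (x : 'cV[R]_m), 0 <= t -> K x -> K (t *: x)].

Definition conv (R : realType) (V : lmodType R) (A : set V) : set V :=
  smallest (@convex_set R V) A.

Definition CPP (R : realType) (m : nat) (K : set 'cV[R]_m) : set 'M[R]_m :=
  [set A | exists (p : nat) (x : 'I_p -> 'cV[R]_m),
     (forall l, K (x l)) /\ A = \sum_(l < p) x l *m (x l)^T].

(* K0 x K1, with R^n1 x R^n2 identified with R^(n1 + n2) *)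
Definition cone_prod (R : realType) (n1 n2 : nat)
    (K0 : set 'cV[R]_n1) (K1 : set 'cV[R]_n2) : set 'cV[R]_(n1 + n2) :=
  [set z | exists x y, [/\ K0 x, K1 y & z = col_mx x y]].

Definition CMP (R : realType) (S n1 n2 : nat) (K0 : set 'cV[R]_n1)
    (K : 'I_S -> set 'cV[R]_n2) : set (sym_tuple R S n1 n2) :=
  conv [set M : sym_tuple R S n1 n2 |
    exists (x : 'cV[R]_n1) (y : 'I_S -> 'cV[R]_n2),
      [/\ K0 x, forall i, K i (y i) &
          forall i, M i = col_mx x (y i) *m (col_mx x (y i))^T]].

Definition CPI (R : realType) (S n1 n2 : nat) (K0 : set 'cV[R]_n1)
    (K : 'I_S -> set 'cV[R]_n2) : set (sym_tuple R S n1 n2) :=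
  [set M : sym_tuple R S n1 n2 | forall i, CPP (cone_prod K0 (K i)) (M i)].

(* Main.v *)
(* Each CPP(K) is a convex cone: sums concatenate the rank-one terms, and a
   factor t >= 0 is absorbed into the vectors as sqrt t. Hence CPI is convex,
   and it contains the generators of CMP. *)
Require Import Defs.
From mathcomp Require Import all_boot all_order all_algebra.
From mathcomp Require Import boolp classical_sets reals topology normedtype convex.
From mathcomp Require Import interval_inference.

Import Order.TTheory GRing.Theory Num.Theory.
Local Open Scope ring_scope.

(** [CMP] is a convex hull, hence contained in every convex set containing its generators. [CPI] is
    such a set: the i-th matrix of a generator is a single rank-one term ([CPP_rank1]), and a convex
    combination is a sum of nonnegative multiples ([CPP_add], [CPP_scale]). *)

Lemma CPP_rank1 (R : realType) (m : nat) (K : set 'cV[R]_m) (x : 'cV[R]_m) :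
  K x -> CPP K (x *m x^T).
Proof. by move=> Kx; exists 1, (fun=> x); rewrite big_ord1. Qed.

Lemma CPP_add (R : realType) (m : nat) (K : set 'cV[R]_m) (A B : 'M[R]_m) :
  CPP K A -> CPP K B -> CPP K (A + B).
Proof.
move=> [p [x [Kx ->]]] [q [y [Ky ->]]].
exists (p + q), (fun l => match split l with inl i => x i | inr j => y j end).
split; first by move=> l; case: split.
rewrite big_split_ord /=; congr (_ + _); apply: eq_bigr => i _.
  (* Seen as an [unsplit], the shifted index cancels against the [split] in the witness. *)
  by rewrite -[lshift _ _]/(unsplit (inl i)) unsplitK.
by rewrite -[rshift _ _]/(unsplit (inr i)) unsplitK.
Qed.

Lemma CPP_scale (R : realType) (m : nat) (K : set 'cV[R]_m) (t : R) (A : 'M[R]_m) :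
  (forall (s : R) (x : 'cV[R]_m), 0 <= s -> K x -> K (s *: x)) ->
  0 <= t -> CPP K A -> CPP K (t *: A).
Proof.
move=> coneK t_ge0 [p [x [Kx ->]]].
exists p, (fun l => Num.sqrt t *: x l); split=> [l|].
  by apply: coneK; rewrite ?sqrtr_ge0.
rewrite scaler_sumr; apply: eq_bigr => l _.
by rewrite [in RHS]linearZ /= -scalemxAl -scalemxAr scalerA -expr2 sqr_sqrtr.
Qed.

Lemma cone_prod_scale (R : realType) (n1 n2 : nat)
    (K0 : set 'cV[R]_n1) (K1 : set 'cV[R]_n2) :
  closed_convex_cone K0 -> closed_convex_cone K1 ->
  forall (t : R) z, 0 <= t -> cone_prod K0 K1 z -> cone_prod K0 K1 (t *: z).
Proof.
move=> [_ _ cone0] [_ _ cone1] t z t_ge0 [x [y [K0x K1y ->]]].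
exists (t *: x), (t *: y); split; [exact: cone0|exact: cone1|].
by rewrite scale_col_mx.
Qed.

(** The shared block is carried by the type [sym_tuple], so convexity is checked one index at a
    time. *)
Lemma CPI_convex (R : realType) (S n1 n2 : nat)
    (K0 : set 'cV[R]_n1) (K : 'I_S -> set 'cV[R]_n2) :
  closed_convex_cone K0 -> (forall i, closed_convex_cone (K i)) ->
  convex_set (CPI K0 K).
Proof.
move=> hK0 hK M N t; rewrite !inE => CM CN i.
have coneP := @cone_prod_scale R n1 n2 K0 (K i) hK0 (hK i).
(* This [conv] is the binary convex combination, not the hull; it is computed componentwise. *)
have -> : (conv t M N : sym_tuple R S n1 n2) i =
    t%:num *: (M : sym_tuple R S n1 n2) i
    + (1 - t%:num) *: (N : sym_tuple R S n1 n2) i.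
  by rewrite /= !ffunE.
by apply: CPP_add; apply: CPP_scale => //; rewrite ?subr_ge0.
Qed.

Theorem theorem10 (R : realType) (S n1 n2 : nat)
  (K0 : set 'cV[R]_n1) (K : 'I_S -> set 'cV[R]_n2)
  (hK0 : closed_convex_cone K0)
  (hK : forall i : 'I_S, closed_convex_cone (K i)) :
  (CMP K0 K `<=` CPI K0 K)%classic.
Proof.
apply: smallest_sub; first exact: CPI_convex.
move=> M [x [y [K0x Ky defM]]] i; rewrite defM.
by apply: CPP_rank1; exists x, (y i).
Qed.
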